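(* Let $c\in(0,\infty]$ and let $\bar r_2^c:=\chi_c^{-1}\circ\bar r_2\circ\chi_c$ be the antipodal $\mathbb{Z}_2$-action on $C(S^2_{qc})$. Then: (a) $\{a\in C(S^2_{qc})\mid\bar r_2^c(a)=a\}\cong C(\mathbb{R}P^2_q)$; (b) $\bar r_2^c=\bar r_1^c\circ\delta_{\sqrt{-1}}=\delta_{\sqrt{-1}}\circ\bar r_1^c$; (c) the antipodal actions are compatible with the $U(1)$-actions: $\delta_g\circ\bar r_2^c=\bar r_2^c\circ\delta_g$ for every $g\in U(1)$.
   Context: Fix $q\in\mathbb{R}$ with $0<|q|<1$. All algebras are unital and over $\mathbb{C}$. The $C^*$-closure of a $*$-algebra means the completion with respect to the supremum norm over all $*$-representations in bounded operators. $C(S^2_{q\infty})$ is the $C^*$-closure of $P(S^2_{q\infty})$, the quotient of the free $*$-algebra $\mathbb{C}\langle A,B\rangle$ by the two-sided $*$-ideal generated by $A^*=A$, $BA=q^2AB$, $B^*B=-A^2+I$, $BB^*=-q^4A^2+I$. For $c\in(0,\infty)$, $C(S^2_{qc})$ is the $C^*$-closure of $P(S^2_{qc})$, the quotient of $\mathbb{C}\langle A_c,B_c\rangle$ by the two-sided $*$-ideal generated by $A_c^*=A_c$, $B_cA_c=q^2A_cB_c$, $B_c^*B_c=A_c-A_c^2+cI$, $B_cB_c^*=q^2A_c-q^4A_c^2+cI$. For $c=\infty$ we write $A_\infty=A$, $B_\infty=B$. Let $\{e_k\}_{k\in\mathbb{N}}$ ($k\ge 0$) be an orthonormal basis of a Hilbert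 space. The representations $\pi_\pm=\pi^\infty_\pm$ of $C(S^2_{q\infty})$ are given by $\pi_\pm(A)e_k=\pm q^{2k}e_k$, $\pi_\pm(B)e_k=(1-q^{4k})^{1/2}e_{k-1}$ for $k\ge1$, $\pi_\pm(B)e_0=0$. For $c\in(0,\infty)$ the representations $\pi^c_\pm$ of $C(S^2_{qc})$ are given by $\pi^c_\pm(A_c)e_k=\lambda_\pm q^{2k}e_k$, $\pi^c_\pm(B_c)e_k=c_\pm(k)^{1/2}e_{k-1}$ for $k\ge1$, $\pi^c_\pm(B_c)e_0=0$, where $\lambda_\pm=\frac12\pm(c+\frac14)^{1/2}$ and $c_\pm(k)=\lambda_\pm q^{2k}-(\lambda_\pm q^{2k})^2+c$. Let $C^*(\mathfrak{S})$ be the $C^*$-algebra generated by the one-sided shift $\mathfrak{S}e_i=e_{i+1}$, $\sigma:C^*(\mathfrak{S})\to C(S^1)$ the symbol map ($\mathfrak{S}\mapsto u$, the unitary generator of $C(S^1)$), and $C^*(\mathfrak{S})\oplus_\sigma C^*(\mathfrak{S}):=\{(a_1,a_2)\mid\sigma(a_1)=\sigma(a_2)\}$. It is known that for all $c\in(0,\infty]$, $\pi_+^c\oplus\pi_-^c:C(S^2_{qc})\to C^*(\mathfrak{S})\oplus_\sigma C^*(\mathfrak{S})$ is a $C^*$-isomorphism. Let $\tau(a,b)=(b,a)$ be the flip on $C^*(\mathfrak{S})\oplus_\sigma C^*(\mathfrak{S})$. Put $\bar r_1:=(\pi_+\oplus\pi_-)^{-1}\circ\tau\circ(\pi_+\oplus\pi_-)$,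 $\chi_c:=(\pi_+\oplus\pi_-)^{-1}\circ(\pi^c_+\oplus\pi^c_-):C(S^2_{qc})\to C(S^2_{q\infty})$, and $\bar r_1^c:=\chi_c^{-1}\circ\bar r_1\circ\chi_c$. For $g\in U(1)$, $\delta_g$ is the $C^*$-automorphism of $C(S^2_{qc})$ determined by $\delta_g(A_c)=A_c$, $\delta_g(B_c)=g^2B_c$. Put $\bar r_2:=\bar r_1\circ\delta_{\sqrt{-1}}:C(S^2_{q\infty})\to C(S^2_{q\infty})$ (so $\bar r_2(A)=-A$, $\bar r_2(B)=-B$) and $C(\mathbb{R}P^2_q):=\{a\in C(S^2_{q\infty})\mid\bar r_2(a)=a\}$. *)

(* Defs.v *)
From HB Require Import structures.
From mathcomp Require Import all_boot all_order all_algebra.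
From mathcomp Require Import all_classical all_reals all_analysis.
From mathcomp Require Import finmap complex.
From mathcomp Require Import -(notations) monalg.
Set Implicit Arguments.
Unset Strict Implicit.
Unset Printing Implicit Defensive.
Import Order.TTheory GRing.Theory Num.Theory numFieldNormedType.Exports.
Local Open Scope classical_set_scope.
Local Open Scope ring_scope.

HB.mixin Record hasStar (R : realType) A of GRing.Algebra R[i] A := {
  star : A -> A;
  starK : involutive star;
  starD : {morph star : x y / x + y};
  starZ : forall (k : R[i]) (x : A), star (k *: x) = (k^*)%C *: star x;
  starM : forall x y : A, star (x * y) = star y * star x }.

#[short(type="starAlgType")]
HB.structure Definition StarAlgebra (R : realType) :=
  {A of hasStar R A & GRing.Algebra R[i] A}.

(* The norm is a field of its own because the class of normed modules has no
   join with the class of rings. *)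
HB.mixin Record isCStar (R : realType) A of StarAlgebra R A := {
  cnorm : A -> R;
  cnormD : forall x y : A, cnorm (x + y) <= cnorm x + cnorm y;
  cnormZ : forall (k : R[i]) (x : A),
    cnorm (k *: x) = complex.Re `|k| * cnorm x;
  cnorm_eq0 : forall x : A, cnorm x = 0 -> x = 0;
  cnormM : forall x y : A, cnorm (x * y) <= cnorm x * cnorm y;
  cnorm_star : forall x : A, cnorm (star x * x) = cnorm x ^+ 2;
  cnorm_complete : forall u : nat -> A,
    (forall eps : R, 0 < eps -> exists N : nat, forall m n : nat,
       (N <= m)%N -> (N <= n)%N -> cnorm (u m - u n) < eps) ->
    exists l : A, forall eps : R, 0 < eps -> exists N : nat, forall n : nat,
      (N <= n)%N -> cnorm (u n - l) < eps }.

#[short(type="cstarAlgType")]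
HB.structure Definition CStarAlgebra (R : realType) :=
  {A of isCStar R A & StarAlgebra R A}.

HB.mixin Record isHilbert (R : realType) H of CompleteNormedModule R[i] H := {
  dotp : H -> H -> R[i];
  dotp_linear : forall z : H, linear_for *%R (dotp^~ z);
  dotp_conj : forall x y : H, dotp y x = ((dotp x y)^*)%C;
  dotpp : forall x : H, dotp x x = `|x| ^+ 2 }.

#[short(type="hilbertType")]
HB.structure Definition Hilbert (R : realType) :=
  {H of isHilbert R H & CompleteNormedModule R[i] H}.

Section Operators.
Context {R : realType} {H : hilbertType R}.
Implicit Types (T : H -> H) (D : set (H -> H)).

Definition bounded_op T : Prop := linear T /\ continuous T.

Definition adjoint T T' : Prop := forall x y, dotp (T x) y = dotp x (T' y).

Definition opnorm T : \bar R :=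
  ereal_sup [set (complex.Re `|T x|)%:E | x in [set x : H | `|x| <= 1]].

Definition orthonormal_basis (e : nat -> H) : Prop :=
  (forall i j, dotp (e i) (e j) = (i == j)%:R) /\
  (forall x, (forall i, dotp x (e i) = 0) -> x = 0).

(* Unital C*-algebras of bounded operators on H. *)
Definition op_cstar D : Prop :=
  [/\ forall T, D T -> bounded_op T,
      D id,
      forall (k : R[i]) T T', D T -> D T' -> D (fun x => k *: T x + T' x),
      forall T T', D T -> D T' -> D (T \o T')
    & (forall T T', D T -> bounded_op T' -> adjoint T T' -> D T') /\
      (forall T, bounded_op T ->
         (forall eps : R, 0 < eps ->
            exists2 T', D T' & (opnorm (T \- T')%R < eps%:E)%E) -> D T)].

Definition cstar_gen D : set (H -> H) := smallest op_cstar D.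

Definition unilateral_shift (e : nat -> H) T : Prop :=
  bounded_op T /\ forall i, T (e i) = e i.+1.

End Operators.

Definition star_rep (R : realType) (A : starAlgType R) (H : hilbertType R)
    (rho : A -> H -> H) : Prop :=
  [/\ forall a, bounded_op (rho a),
      forall (k : R[i]) a b x, rho (k *: a + b) x = k *: rho a x + rho b x,
      rho 1 = id,
      forall a b, rho (a * b) = rho a \o rho b
    & forall a, adjoint (rho a) (rho (star a))].

Definition star_hom_on (R : realType) (A B : starAlgType R) (D : set A)
    (f : A -> B) : Prop :=
  [/\ f 1 = 1,
      forall (k : R[i]) a b, D a -> D b -> f (k *: a + b) = k *: f a + f b,
      forall a b, D a -> D b -> f (a * b) = f a * f b
    & forall a, D a -> f (star a) = star (f a)].

Definition cstar_iso (R : realType) (A B : cstarAlgType R) (D : set A)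
    (E : set B) (f : A -> B) : Prop :=
  [/\ set_bij D E f, star_hom_on D f & forall a, D a -> cnorm (f a) = cnorm a].

Definition cstar_isomorphic (R : realType) (A B : cstarAlgType R) (D : set A)
    (E : set B) : Prop :=
  exists f : A -> B, cstar_iso D E f.

(* The inverse of a bijection of A onto a subset of T. *)
Definition cinv (R : realType) (A : cstarAlgType R) (T : Type) (f : A -> T) :
    T -> A :=
  'pinv_(fun=> 0) [set: A] f.

Definition universal_norm (R : realType) (P : starAlgType R) (p : P) : \bar R :=
  ereal_sup [set r | exists (H : hilbertType R) (rho : P -> H -> H),
                       star_rep rho /\ r = opnorm (rho p)].

(* A completion of P, separated by the null space of the seminorm. *)
Record cstar_closure (R : realType) (P : starAlgType R) := CStarClosure {
  closure_sort :> cstarAlgType R;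
  to_closure : P -> closure_sort;
  to_closure_hom : star_hom_on [set: P] to_closure;
  to_closure_norm : forall p, (cnorm (to_closure p))%:E = universal_norm p;
  to_closure_dense : forall (a : closure_sort) (eps : R), 0 < eps ->
    exists p, cnorm (a - to_closure p) < eps }.

Arguments to_closure {R P} c p.

Section WordAlgebra.
Context (C : comNzRingType) (cj : {rmorphism C -> C}) (cjK : involutive cj).
Context (I : choiceType).
Local Notation W := (fmonom (I * bool)%type).
Local Notation F := (malg W C).
Implicit Types (k : C) (v w : W) (x y : F).

Lemma malg_scalerAr k x y : k *: (x * y) = x * (k *: y).
Proof.
apply/malgP => w.
rewrite (mcoeffZ k (x * y) w) (mcoeffMl x y w).
rewrite (mcoeffMlw w (fsubset_refl _) (msuppZ_le k y)) mulr_sumr.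
apply: eq_bigr => u _; rewrite mulr_sumr; apply: eq_bigr => v _.
by rewrite (mcoeffZ k y v) mulrnAr mulrCA.
Qed.

Definition wstar w : W :=
  FMonom (rev [seq (l.1, ~~ l.2) | l <- fmonom_val w]).

Lemma wstarK : involutive wstar.
Proof.
case=> s; rewrite /wstar /= map_rev revK -map_comp.
congr FMonom; rewrite -[RHS]map_id; apply: eq_map => -[i b] /=.
by rewrite negbK.
Qed.

Lemma wstarM v w : wstar (mmul v w) = mmul (wstar w) (wstar v).
Proof.
by apply: val_inj; rewrite [RHS]fmM /wstar fmM map_cat rev_cat.
Qed.

Definition fstar x : F :=
  \sum_(w <- msupp x) mkmalgU (wstar w) (cj (mcoeff w x)).

Lemma mcoeff_fstar w x : mcoeff w (fstar x) = cj (mcoeff (wstar w) x).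
Proof.
rewrite /fstar raddf_sum /=.
under eq_bigr => v _ do rewrite mcoeffU.
have [ws|ws] := boolP (wstar w \in msupp x).
  rewrite (big_fsetD1 (wstar w)) //= wstarK eqxx mulr1n big_seq big1 ?addr0 //.
  move=> v; rewrite in_fsetD1 => /andP[vw _]; case: eqP => // wvw.
  by case/eqP: vw; rewrite -wvw wstarK.
rewrite (mcoeff_outdom ws) rmorph0 big_seq big1 // => v vx.
by case: eqP => // wvw; move: ws; rewrite -wvw wstarK vx.
Qed.

Lemma fstarK : involutive fstar.
Proof. by move=> x; apply/malgP => w; rewrite !mcoeff_fstar wstarK cjK. Qed.

Lemma fstarD : {morph fstar : x y / x + y}.
Proof.
move=> x y; apply/malgP => w.
by rewrite (mcoeffD w (fstar x)) !mcoeff_fstar (mcoeffD _ x) rmorphD.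
Qed.

Lemma fstarZ k x : fstar (k *: x) = cj k *: fstar x.
Proof.
apply/malgP => w.
by rewrite (mcoeffZ (cj k)) !mcoeff_fstar (mcoeffZ k) rmorphM.
Qed.

Lemma fstarU w k : fstar (mkmalgU w k) = mkmalgU (wstar w) (cj k).
Proof.
apply/malgP => v; rewrite mcoeff_fstar !mcoeffU rmorphMn /=.
by congr (_ *+ _); rewrite (can2_eq wstarK wstarK).
Qed.

Lemma fstar0 : fstar 0 = 0.
Proof. by rewrite /fstar msupp0 big_seq_fset0. Qed.

Lemma fstarM x y : fstar (x * y) = fstar y * fstar x.
Proof.
rewrite malgME (big_morph fstar fstarD fstar0).
under eq_bigr => v _ do rewrite (big_morph fstar fstarD fstar0).
rewrite exchange_big /= [fstar y]/fstar mulr_suml; apply: eq_bigr => w _.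
rewrite [fstar x]/fstar mulr_sumr; apply: eq_bigr => v _.
by rewrite malgM_def fgmulUU fstarU wstarM rmorphM mulrC.
Qed.

Definition word_eval (t : I * bool -> C) w : C :=
  \prod_(l <- fmonom_val w) t l.

Lemma word_eval1 t : word_eval t mone = 1.
Proof. by rewrite /word_eval fm1 big_nil. Qed.

Lemma word_evalM t : {morph word_eval t : v w / mmul v w >-> v * w}.
Proof. by move=> v w; rewrite /word_eval fmM big_cat. Qed.

HB.instance Definition _ t :=
  monalg.isMultiplicative.Build W C (word_eval t)
    (conj (word_evalM t) (word_eval1 t)).

Definition feval t : F -> C := mmap idfun (word_eval t).

HB.instance Definition _ t :=
  GRing.RMorphism.copy (feval t) (mmap idfun (word_eval t)).

Lemma feval_fgen t l : feval t (mkmalgU (fmu l) 1) = t l.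
Proof. by rewrite /feval mmapU mul1r /word_eval fmU big_seq1. Qed.

Lemma fevalZ t k x : feval t (k *: x) = k * feval t x.
Proof. exact: mmapZ. Qed.

End WordAlgebra.

(* Polynomials in the noncommuting letters (i, false) = i and (i, true) = i^*. *)
Definition free_star (R : realType) (I : choiceType) :=
  malg (fmonom (I * bool)%type) R[i].

Section FreeStar.
Context (R : realType) (I : choiceType).
Local Notation F := (free_star R I).

HB.instance Definition _ := GRing.Lalgebra.on F.
HB.instance Definition _ :=
  GRing.Lalgebra_isAlgebra.Build R[i] F (@malg_scalerAr R[i] I).
HB.instance Definition _ := hasStar.Build R F
  (@fstarK R[i] (@conjc R) (@conjcK R) I) (@fstarD R[i] (@conjc R) I)
  (@fstarZ R[i] (@conjc R) I) (@fstarM R[i] (@conjc R) I).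

Definition fgen (i : I) : F := mkmalgU (fmu (i, false)) 1.

End FreeStar.

Definition star_ideal (R : realType) (A : starAlgType R) (J : set A) : Prop :=
  [/\ J 0,
      forall x y, J x -> J y -> J (x - y),
      forall a x, J x -> J (a * x),
      forall a x, J x -> J (x * a)
    & forall x, J x -> J (star x)].

Definition star_ideal_gen (R : realType) (A : starAlgType R) (X : set A) :
    set A :=
  smallest (@star_ideal R A) X.

Lemma star_ideal_genP (R : realType) (A : starAlgType R) (X : set A) :
  star_ideal (star_ideal_gen X).
Proof.
split=> [K [[K0 _ _ _ _] _] //|x y Jx Jy K KX|a x Jx K KX|a x Jx K KX|x Jx K KX].
- by have [[_ KB _ _ _] _] := KX; exact: KB (Jx K KX) (Jy K KX).
- by have [[_ _ Kl _ _] _] := KX; exact: Kl (Jx K KX).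
- by have [[_ _ _ Kr _] _] := KX; exact: Kr (Jx K KX).
- by have [[_ _ _ _ Ks] _] := KX; exact: Ks (Jx K KX).
Qed.

(* The structure of (unital) algebras excludes the zero algebra, whence the
   restriction to proper ideals. *)
Record proper_star_ideal (R : realType) (A : starAlgType R) := ProperStarIdeal {
  ideal_set : set A;
  ideal_setP : star_ideal ideal_set;
  ideal_proper : ~ ideal_set 1 }.

Section StarQuotient.
Context (R : realType) (A : starAlgType R) (J : proper_star_ideal A).
Implicit Types (x y : A) (k : R[i]).

Definition ideal_pred : pred A := fun x => `[< ideal_set J x >].

Lemma ideal_pred_closed : zmod_closed ideal_pred.
Proof.
have [J0 JB _ _ _] := ideal_setP J.
split=> [|x y]; rewrite !unfold_in; first exact/asboolP.
by move=> /asboolP Jx /asboolP Jy; apply/asboolP/JB.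
Qed.

HB.instance Definition _ :=
  GRing.isZmodClosed.Build A ideal_pred ideal_pred_closed.
Definition ideal_closed : zmodClosed A := GRing.ZmodClosed.clone A ideal_pred _.

Definition star_quot : Type := {ideal_quot ideal_closed}.
Local Notation Q := star_quot.

HB.instance Definition _ := GRing.Zmodule.on Q.

Definition quot_pi (x : A) : Q := \pi_({ideal_quot ideal_closed})%qT x.
Definition quot_repr (u : Q) : A :=
  generic_quotient.repr (u : {ideal_quot ideal_closed}).

Lemma quot_reprK u : quot_pi (quot_repr u) = u.
Proof. exact: generic_quotient.reprK. Qed.

Lemma quot_piP x y : quot_pi x = quot_pi y <-> ideal_set J (x - y).
Proof.
split=> [/eqP|Jxy]; last apply/eqP.
  by rewrite /quot_pi -Quotient.idealrBE => /asboolP.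
by rewrite /quot_pi -Quotient.idealrBE; apply/asboolP.
Qed.

Lemma quot_reprP x : ideal_set J (quot_repr (quot_pi x) - x).
Proof. by apply/quot_piP; rewrite quot_reprK. Qed.

Lemma quot_piD x y : quot_pi (x + y) = quot_pi x + quot_pi y.
Proof. exact: Quotient.pi_add. Qed.

Lemma quot_pi0 : quot_pi 0 = 0.
Proof. by apply: (addrI (quot_pi 0)); rewrite -quot_piD !addr0. Qed.

Lemma quot_ind (P : Q -> Prop) : (forall x, P (quot_pi x)) -> forall u, P u.
Proof. by move=> Px u; rewrite -(quot_reprK u). Qed.

Definition quot_mul (u v : Q) : Q := quot_pi (quot_repr u * quot_repr v).
Definition quot_scale k (u : Q) : Q := quot_pi (k *: quot_repr u).
Definition quot_star (u : Q) : Q := quot_pi (star (quot_repr u)).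

Lemma quot_piM x y : quot_mul (quot_pi x) (quot_pi y) = quot_pi (x * y).
Proof.
have [J0 JB Jl Jr _] := ideal_setP J; apply/quot_piP.
have JD a b : ideal_set J a -> ideal_set J b -> ideal_set J (a + b).
  move=> Ja Jb; rewrite -[b]opprK; apply: (JB _ _ Ja).
  by rewrite -sub0r; apply: JB.
rewrite (_ : _ - _ = (quot_repr (quot_pi x) - x) * quot_repr (quot_pi y)
                     + x * (quot_repr (quot_pi y) - y)).
  by apply: JD; [apply/Jr/quot_reprP|apply/Jl/quot_reprP].
by rewrite mulrBl mulrBr addrA subrK.
Qed.

Lemma quot_piZ k x : quot_scale k (quot_pi x) = quot_pi (k *: x).
Proof.
have [_ _ Jl _ _] := ideal_setP J; apply/quot_piP.
by rewrite -scalerBr -[_ - _]mul1r scalerAl; apply/Jl/quot_reprP.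
Qed.

Lemma starB x y : star (x - y) = star x - star y.
Proof. by rewrite starD -scaleN1r starZ rmorphN rmorph1 scaleN1r. Qed.

Lemma quot_piS x : quot_star (quot_pi x) = quot_pi (star x).
Proof.
have [_ _ _ _ Js] := ideal_setP J; apply/quot_piP.
by rewrite -starB; apply/Js/quot_reprP.
Qed.

Lemma quot_mulA : associative quot_mul.
Proof.
elim/quot_ind=> x; elim/quot_ind=> y; elim/quot_ind=> z.
by rewrite !quot_piM mulrA.
Qed.

Lemma quot_mul1l : left_id (quot_pi 1) quot_mul.
Proof. by elim/quot_ind=> x; rewrite quot_piM mul1r. Qed.

Lemma quot_mul1r : right_id (quot_pi 1) quot_mul.
Proof. by elim/quot_ind=> x; rewrite quot_piM mulr1. Qed.

Lemma quot_mulDl : left_distributive quot_mul +%R.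
Proof.
elim/quot_ind=> x; elim/quot_ind=> y; elim/quot_ind=> z.
by rewrite -quot_piD !quot_piM -quot_piD mulrDl.
Qed.

Lemma quot_mulDr : right_distributive quot_mul +%R.
Proof.
elim/quot_ind=> x; elim/quot_ind=> y; elim/quot_ind=> z.
by rewrite -quot_piD !quot_piM -quot_piD mulrDr.
Qed.

Lemma quot_1neq0 : quot_pi 1 != 0.
Proof.
apply/eqP; rewrite -quot_pi0 => /quot_piP; rewrite subr0.
exact: ideal_proper.
Qed.

HB.instance Definition _ := GRing.Zmodule_isNzRing.Build Q
  quot_mulA quot_mul1l quot_mul1r quot_mulDl quot_mulDr quot_1neq0.

Lemma quot_scaleA k l u : quot_scale k (quot_scale l u) = quot_scale (k * l) u.
Proof. by elim/quot_ind: u => x; rewrite !quot_piZ scalerA. Qed.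

Lemma quot_scale1 : left_id 1 quot_scale.
Proof. by elim/quot_ind=> x; rewrite quot_piZ scale1r. Qed.

Lemma quot_scaleDr : right_distributive quot_scale +%R.
Proof.
move=> k; elim/quot_ind=> x; elim/quot_ind=> y.
by rewrite -quot_piD !quot_piZ -quot_piD scalerDr.
Qed.

Lemma quot_scaleDl u : {morph quot_scale^~ u : k l / k + l}.
Proof.
by move=> k l; elim/quot_ind: u => x; rewrite !quot_piZ -quot_piD scalerDl.
Qed.

HB.instance Definition _ := GRing.Zmodule_isLmodule.Build R[i] Q
  quot_scaleA quot_scale1 quot_scaleDr quot_scaleDl.

Lemma quot_scaleAl k (u v : Q) : k *: (u * v) = (k *: u) * v.
Proof.
elim/quot_ind: u => x; elim/quot_ind: v => y.
rewrite -[LHS]/(quot_scale k (quot_mul _ _)) -[RHS]/(quot_mul (quot_scale k _) _).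
by rewrite quot_piM !quot_piZ quot_piM scalerAl.
Qed.

HB.instance Definition _ := GRing.Lmodule_isLalgebra.Build R[i] Q quot_scaleAl.

Lemma quot_scaleAr k (u v : Q) : k *: (u * v) = u * (k *: v).
Proof.
elim/quot_ind: u => x; elim/quot_ind: v => y.
rewrite -[LHS]/(quot_scale k (quot_mul _ _)) -[RHS]/(quot_mul _ (quot_scale k _)).
by rewrite quot_piM !quot_piZ quot_piM scalerAr.
Qed.

HB.instance Definition _ := GRing.Lalgebra_isAlgebra.Build R[i] Q quot_scaleAr.

Lemma quot_starK : involutive quot_star.
Proof. by elim/quot_ind=> x; rewrite !quot_piS starK. Qed.

Lemma quot_starD : {morph quot_star : u v / u + v}.
Proof.
elim/quot_ind=> x; elim/quot_ind=> y.
by rewrite -quot_piD !quot_piS -quot_piD starD.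
Qed.

Lemma quot_starZ k (u : Q) : quot_star (k *: u) = (k^*)%C *: quot_star u.
Proof.
elim/quot_ind: u => x.
rewrite -[LHS]/(quot_star (quot_scale k _)) -[RHS]/(quot_scale _ _).
by rewrite quot_piZ !quot_piS quot_piZ starZ.
Qed.

Lemma quot_starM (u v : Q) : quot_star (u * v) = quot_star v * quot_star u.
Proof.
elim/quot_ind: u => x; elim/quot_ind: v => y.
rewrite -[LHS]/(quot_star (quot_mul _ _)) -[RHS]/(quot_mul _ _).
by rewrite quot_piM !quot_piS quot_piM starM.
Qed.

HB.instance Definition _ := hasStar.Build R Q
  quot_starK quot_starD quot_starZ quot_starM.

End StarQuotient.

Section PodlesAlgebra.
Context {R : realType}.

(* For c = -oo, which never occurs below, these are the relations at +oo. *)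
Definition podles_relations (P : starAlgType R) (A B : P) (q : R)
    (c : \bar R) : set P :=
  let k n := ((q ^+ n)%:C)%C in
  [set star A - A;
       B * A - k 2%N *: (A * B);
       star B * B - (if c is r%:E then A - A ^+ 2 + (r%:C)%C *: 1
                     else - A ^+ 2 + 1);
       B * star B - (if c is r%:E
                     then k 2%N *: A - k 4%N *: A ^+ 2 + (r%:C)%C *: 1
                     else - (k 4%N *: A ^+ 2) + 1)].

Local Notation F := (free_star R bool).

Definition podles_ideal_set (q : R) (c : \bar R) : set F :=
  star_ideal_gen (podles_relations (fgen R false) (fgen R true) q c).

(* The ideal is proper: A, A^* |-> 0, B |-> 1, B^* |-> c (1 if c is infinite)
   defines a character of the free algebra that kills it. *)
Definition character_value (c : \bar R) : R[i] :=
  if c is r%:E then (r%:C)%C else 1.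

Lemma character_relations (P : starAlgType R) (f : {rmorphism P -> R[i]})
    (fZ : forall k x, f (k *: x) = k * f x) (A B : P) (q : R) (c : \bar R) :
    f A = 0 -> f (star A) = 0 -> f B = 1 -> f (star B) = character_value c ->
  forall x, star_ideal_gen (podles_relations A B q c) x -> f x = 0.
Proof.
move=> fA fSA fB fSB.
have star1 : star 1 = 1 :> P.
  by have := starM (star (1 : P)) 1; rewrite mulr1 !starK mulr1.
have star0 : star 0 = 0 :> P.
  by apply: (addrI (star 0)); rewrite -starD !addr0.
have starN (x : P) : star (- x) = - star x.
  by rewrite -sub0r starB star0 sub0r.
have fSX : f (star (A ^+ 2)) = 0 by rewrite expr2 starM rmorphM fSA mul0r.
have fX : f (A ^+ 2) = 0 by rewrite expr2 rmorphM fA mul0r.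
move=> x /(_ [set x | f x = 0 /\ f (star x) = 0]) []; last by [].
split.
  split=> [|y z [fy fy'] [fz fz']|a y [fy fy']|a y [fy fy']|y [fy fy']] /=.
  - by rewrite star0 rmorph0.
  - by rewrite starB !rmorphB fy fy' fz fz' subrr.
  - by rewrite starM !rmorphM fy fy' mulr0 mul0r.
  - by rewrite starM !rmorphM fy fy' mulr0 mul0r.
  - by rewrite starK.
move=> y /= [[[]|]|] ->.
- by rewrite starB !rmorphB starK fA fSA subrr.
- rewrite starB starZ !rmorphB !fZ !starM !rmorphM fA fSA.
  by rewrite !(mulr0, mul0r) subrr.
- rewrite starB !rmorphB starM starK !rmorphM fB fSB mulr1.
  case: c fSB => [r||] fSB /=; rewrite !starD !starN ?starZ !rmorphD !rmorphN;
    rewrite ?fZ star1 rmorph1 fSX fX ?fA ?fSA ?conjc_real ?mulr1 oppr0 ?add0r;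
    by rewrite subrr.
- rewrite starB !rmorphB starM starK !rmorphM fB fSB mul1r.
  case: c fSB => [r||] fSB /=; rewrite !starD !starN ?starZ !rmorphD !rmorphN;
    rewrite ?fZ star1 rmorph1 fSX fX ?fA ?fSA ?conjc_real ?mulr0 ?mulr1 oppr0;
    by rewrite ?add0r subrr.
Qed.

Lemma podles_ideal_proper (q : R) (c : \bar R) : ~ podles_ideal_set q c 1.
Proof.
pose ev (l : bool * bool) : R[i] :=
  if l.1 then (if l.2 then character_value c else 1) else 0.
have fg l : feval ev (mkmalgU (fmu l) 1) = ev l by exact: feval_fgen.
have sg (b : bool) :
    star (fgen R b : F)
    = @mkmalgU (fmonom (bool * bool)%type) R[i] (fmu (b, true)) 1.
  apply: etrans (@fstarU R[i] (@conjc R) bool (fmu (b, false)) 1) _.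
  by rewrite rmorph1; congr mkmalgU; apply: val_inj; rewrite /= !fmU.
move=> /(@character_relations F (feval ev) (fevalZ ev)) f1.
have : feval ev 1 = 0 :> R[i].
  by apply: f1; rewrite ?sg; exact: fg.
by move/eqP; rewrite rmorph1 oner_eq0.
Qed.

Definition podles_ideal (q : R) (c : \bar R) : proper_star_ideal F :=
  ProperStarIdeal (star_ideal_genP _) (@podles_ideal_proper q c).

Definition podles (q : R) (c : \bar R) : starAlgType R :=
  star_quot (podles_ideal q c).

Definition podles_A (q : R) (c : \bar R) : podles q c :=
  quot_pi (podles_ideal q c) (fgen R false).
Definition podles_B (q : R) (c : \bar R) : podles q c :=
  quot_pi (podles_ideal q c) (fgen R true).

End PodlesAlgebra.

Section Toeplitz.
Context {R : realType} {H : hilbertType R}.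

Definition circle : set R[i]^o := [set z | `|z| = 1].

Definition toeplitz (S : H -> H) : set (H -> H) := cstar_gen [set S].

(* A star-homomorphism of toeplitz S into C(S^1) sending S to the inclusion u of
   the circle; values of sigma outside of toeplitz S are irrelevant. *)
Definition symbol_map (S : H -> H) (sigma : (H -> H) -> circle -> R[i]^o) :
    Prop :=
  [/\ forall T, toeplitz S T -> continuous (sigma T),
      forall z, sigma S z = set_val z,
      forall z, sigma id z = 1,
      forall (k : R[i]) T T' z, toeplitz S T -> toeplitz S T' ->
        sigma (fun x => k *: T x + T' x) z = k * sigma T z + sigma T' z
    & (forall T T' z, toeplitz S T -> toeplitz S T' ->
        sigma (T \o T') z = sigma T z * sigma T' z) /\
      (forall T T' z, toeplitz S T -> toeplitz S T' -> adjoint T T' ->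
        sigma T' z = ((sigma T z)^*)%C)].

Definition toeplitz_pullback (S : H -> H)
    (sigma : (H -> H) -> circle -> R[i]^o) : set ((H -> H) * (H -> H)) :=
  [set a | [/\ toeplitz S a.1, toeplitz S a.2 & sigma a.1 = sigma a.2]].

(* C*-isomorphisms onto a C*-algebra of pairs of operators. *)
Definition pair_cstar_iso (A : cstarAlgType R) (D : set ((H -> H) * (H -> H)))
    (f : A -> (H -> H) * (H -> H)) : Prop :=
  [/\ star_rep (fun a => (f a).1), star_rep (fun a => (f a).2),
      set_bij [set: A] D f
    & forall a, (cnorm a)%:E = maxe (opnorm (f a).1) (opnorm (f a).2)].

End Toeplitz.

Section PodlesSpheres.
Context {R : realType}.
Implicit Types (q : R) (c : \bar R) (s : bool).

(* The parameters c in (0, +oo]. *)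
Definition podles_param := {c : \bar R | (0 < c)%E}.
Definition param_infty : podles_param := exist _ +oo%E (@lt0y R).

Definition closure_A q c (C : cstar_closure (podles q c)) : C :=
  to_closure C (podles_A q c).
Definition closure_B q c (C : cstar_closure (podles q c)) : C :=
  to_closure C (podles_B q c).

(* The sign + is encoded by false and - by true. *)
Definition podles_lambda c s : R :=
  if c is r%:E then 2^-1 + (-1) ^+ s * Num.sqrt (r + 4^-1) else (-1) ^+ s.

Definition podles_weight q c s (k : nat) : R :=
  if c is r%:E
  then podles_lambda c s * q ^+ (2 * k)
       - (podles_lambda c s * q ^+ (2 * k)) ^+ 2 + r
  else 1 - q ^+ (4 * k).

Definition podles_rep q c s (C : cstar_closure (podles q c))
    (H : hilbertType R) (e : nat -> H) (rho : C -> H -> H) : Prop :=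
  [/\ star_rep rho,
      forall k, rho (closure_A C) (e k)
                = ((podles_lambda c s * q ^+ (2 * k))%:C)%C *: e k,
      forall k, rho (closure_B C) (e k.+1)
                = ((Num.sqrt (podles_weight q c s k.+1))%:C)%C *: e k
    & rho (closure_B C) (e 0%N) = 0].

Definition gauge_automorphism q c (C : cstar_closure (podles q c)) (g : R[i])
    (d : C -> C) : Prop :=
  [/\ cstar_iso [set: C] [set: C] d,
      d (closure_A C) = closure_A C
    & d (closure_B C) = (g ^+ 2) *: closure_B C].

End PodlesSpheres.

Arguments podles_param : clear implicits.
Arguments param_infty : clear implicits.
Arguments circle : clear implicits.

(* Main.v *)
Require Import Defs.
From HB Require Import structures.
From mathcomp Require Import all_boot all_order all_algebra.
From mathcomp Require Import all_classical all_reals all_analysis.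
From mathcomp Require Import finmap complex.
From mathcomp Require Import ring.
From mathcomp Require Import -(notations) monalg.
Set Implicit Arguments.
Unset Strict Implicit.
Unset Printing Implicit Defensive.
Import Order.TTheory GRing.Theory Num.Theory numFieldNormedType.Exports.
Local Open Scope classical_set_scope.
Local Open Scope ring_scope.

(** Let [u] be the unitary that multiplies [e k] by the [-k]-th power of [g ^ 2].
    In each representation [pi c s] the gauge automorphism [delta c g] is
    conjugation by [u]: indeed [A] is diagonal and [B] lowers the index by one.
    The point is that [u] depends neither on the parameter [c] nor on the sign
    [s].  Hence, seen through the isomorphisms onto the Toeplitz pullback, all
    the gauge actions are one and the same action, it commutes with the flip of
    the two components, and gauge automorphisms commute with each other.
    Everything claimed follows formally: [chi] intertwines the gauge actions,
    so (b) and (c) on the sphere of parameter [c] are transported from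
    the sphere at infinity, and [chi] maps the fixed points of [r2c] onto those
    of [r2], which is (a).

    The unitary [u] itself is never built, which would require summing
    orthogonal series.  Conjugation by [u] is expressed on matrix coefficients
    instead ([gauge_coef]); they determine the operators of a
    star-representation ([rep_eq]).  The identity of coefficients is stable
    under left multiplication by the generators and their adjoints, under
    linear combinations and under norm limits, so that it holds on the whole
    completion ([closure_podles_ind]). *)

(** * Inner products *)

Section InnerProduct.
Context {R : realType} {H : hilbertType R}.
Implicit Types (x y z : H) (k : R[i]).

Lemma dotpDl x y z : dotp (x + y) z = dotp x z + dotp y z.
Proof. by have := dotp_linear z 1 x y; rewrite scale1r mul1r. Qed.

Lemma dotp0l z : dotp 0 z = 0.
Proof. by apply: (addrI (dotp 0 z)); rewrite -dotpDl !addr0. Qed.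

Lemma dotpZl k x z : dotp (k *: x) z = k * dotp x z.
Proof. by have := dotp_linear z k x 0; rewrite addr0 dotp0l addr0. Qed.

Lemma dotpBl x y z : dotp (x - y) z = dotp x z - dotp y z.
Proof. by rewrite dotpDl -scaleN1r dotpZl mulN1r. Qed.

Lemma dotpBr x y z : dotp z (x - y) = dotp z x - dotp z y.
Proof. by rewrite dotp_conj dotpBl rmorphB /= -!dotp_conj. Qed.

Lemma dotpZr k x z : dotp z (k *: x) = (k^*)%C * dotp z x.
Proof. by rewrite dotp_conj dotpZl rmorphM /= -dotp_conj. Qed.

Lemma dotp0r z : dotp z 0 = 0.
Proof. by rewrite dotp_conj dotp0l rmorph0. Qed.

(** The Cauchy-Schwarz inequality against a unit vector: expand the squared norm
    of the component of [x] orthogonal to [u]. *)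
Lemma dotp_unit_le x (u : H) : dotp u u = 1 -> `|dotp x u| <= `|x|.
Proof.
move=> u1; rewrite -ler_sqr ?nnegrE //.
have : 0 <= `|x - dotp x u *: u| ^+ 2 by exact: exprn_ge0.
rewrite -dotpp dotpBl !dotpBr !dotpZl !dotpZr u1 mulr1 (dotp_conj x u).
by rewrite (mulrC (dotp x u)^*%C) subrr subr0 dotpp -sqr_normc subr_ge0.
Qed.

Lemma basis_ext (e : nat -> H) x y : orthonormal_basis e ->
  (forall i, dotp x (e i) = dotp y (e i)) -> x = y.
Proof.
move=> [_ tot] xy; apply/eqP; rewrite -subr_eq0; apply/eqP/tot => i.
by rewrite dotpBl xy subrr.
Qed.

End InnerProduct.

Lemma normc_le_real (R : realType) (z : R[i]) (r : R) :
  (`|z| <= (r%:C)%C) = (complex.Re `|z| <= r).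
Proof. by rewrite lecE normc_def /= eqxx. Qed.

(** * Matrix coefficients of star-representations *)

Section Representations.
Context {R : realType} {H : hilbertType R}.

Lemma rep_adj (A : starAlgType R) (rho : A -> H -> H) a x y : star_rep rho ->
  dotp (rho (star a) x) y = dotp x (rho a y).
Proof. by case=> _ _ _ _ adj; rewrite adj starK. Qed.

Lemma rep_scale (A : starAlgType R) (rho : A -> H -> H) k a x : star_rep rho ->
  rho (k *: a) x = k *: rho a x.
Proof.
case=> _ rD _ _ _.
have r0 : rho 0 x = 0.
  have := rD 1 0 0 x; rewrite !scale1r addr0 => h.
  by apply: (addrI (rho 0 x)); rewrite -h addr0.
by have := rD k a 0 x; rewrite addr0 r0 addr0.
Qed.

(** Equal coefficients first give equality on basis vectors, by totality of [e].
    To reach all vectors without any series expansion, apply this to the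
    adjoints, which are the images of [star a] and [star b] and whose
    coefficients are conjugate to the given ones. *)
Lemma rep_eq (A B : starAlgType R) (rho : A -> H -> H) (rho' : B -> H -> H)
    (e : nat -> H) a b :
  orthonormal_basis e -> star_rep rho -> star_rep rho' ->
  (forall i j, dotp (rho a (e i)) (e j) = dotp (rho' b (e i)) (e j)) ->
  rho a = rho' b.
Proof.
move=> he rA rB ab; apply: funext => x; apply: (basis_ext he) => k.
have [_ _ _ _ ->] := rA; have [_ _ _ _ ->] := rB; congr dotp.
by apply: (basis_ext he) => j; rewrite !rep_adj // [LHS]dotp_conj ab -dotp_conj.
Qed.

Lemma opnorm_coef_le (T : H -> H) (e : nat -> H) (r : R) i j :
  orthonormal_basis e -> (opnorm T <= r%:E)%E ->
  complex.Re `|dotp (T (e i)) (e j)| <= r.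
Proof.
move=> [on _] Tr.
have e1 k : dotp (e k) (e k) = 1 by rewrite on eqxx.
have ei1 : `|e i| <= 1.
  by rewrite -(@ler_pXn2r _ 2) ?nnegrE // -dotpp e1 expr1n.
have : `|dotp (T (e i)) (e j)| <= `|T (e i)| by exact: dotp_unit_le.
rewrite lecE => /andP[_ /le_trans]; apply.
rewrite -lee_fin; apply: le_trans Tr; apply: ereal_sup_ubound.
by exists (e i).
Qed.

End Representations.

(** * Words in the generators *)

Section FreeAlgebra.
Context {R : realType} {I : choiceType}.
Local Notation F := (free_star R I).

Lemma fgen_star (i : I) :
  star (fgen R i : F) = @mkmalgU (fmonom (I * bool)%type) R[i] (fmu (i, true)) 1.
Proof.
apply: etrans (@fstarU R[i] (@conjc R) I (fmu (i, false)) 1) _.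
by rewrite rmorph1; congr mkmalgU; apply: val_inj; rewrite /= !fmU.
Qed.

(** The letters [(i, false)] and [(i, true)] are [fgen i] and its adjoint, words
    are built by prepending letters, and every element is a combination of words. *)
Lemma free_star_ind (P : F -> Prop) :
  P 1 -> (forall k x y, P x -> P y -> P (k *: x + y)) ->
  (forall i x, P x -> P (fgen R i * x)) ->
  (forall i x, P x -> P (star (fgen R i : F) * x)) ->
  forall x, P x.
Proof.
move=> P1 PD Pg Ps.
have P0 : P 0 by rewrite -(addNr 1) -scaleN1r; exact: PD.
have Pw (s : seq (I * bool)) : P (mkmalgU (FMonom s) 1).
  elim: s => [|[i b] s IH].
    suff -> : mkmalgU (FMonom [::]) 1 = 1 :> F by [].
    by congr mkmalgU; apply: val_inj; rewrite /= fm1.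
  have -> : mkmalgU (FMonom ((i, b) :: s)) 1
      = (mkmalgU (fmu (i, b)) 1 : F) * mkmalgU (FMonom s) 1 :> F.
    rewrite malgM_def fgmulUU mulr1; congr mkmalgU.
    by apply: val_inj; rewrite /= fmM fmU.
  by case: b; [rewrite -fgen_star; exact: Ps|exact: Pg].
move=> x; rewrite [x]monalgE; elim: (X in \sum_(_ <- X) _) => [|w s IH].
  by rewrite big_nil.
rewrite big_cons.
have -> : mkmalgU w (mcoeff w x) = mcoeff w x *: (mkmalgU w 1 : F).
  by apply/malgP => v; rewrite (mcoeffZ _ (mkmalgU w 1 : F)) !mcoeffU mulrnAr mulr1.
by apply: PD => //; case: w.
Qed.

End FreeAlgebra.

(** The induction principle by which an identity of matrix coefficients is
    verified on the whole completion.  Asking only for left multiplication by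
    generators matters: the coefficients of a product of two arbitrary elements
    are infinite sums, whereas a generator merely rescales and shifts them. *)
Lemma closure_podles_ind (R : realType) (q : R) (c : \bar R)
    (C : cstar_closure (podles q c)) (P : C -> Prop) :
  P 1 -> (forall k a b, P a -> P b -> P (k *: a + b)) ->
  (forall a, P a -> P (closure_A C * a)) ->
  (forall a, P a -> P (star (closure_A C) * a)) ->
  (forall a, P a -> P (closure_B C * a)) ->
  (forall a, P a -> P (star (closure_B C) * a)) ->
  (forall a, (forall eps : R, 0 < eps -> exists2 b, P b & cnorm (a - b) < eps) ->
     P a) ->
  forall a, P a.
Proof.
move=> P1 PD PA PA' PB PB' Pcl a; apply: Pcl => eps /(to_closure_dense a)[p ap].
exists (to_closure C p) => //.
have [t1 tD tM tS] := to_closure_hom C.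
move: p {ap}; elim/quot_ind; apply: free_star_ind => [|k x y Px Py|i x Px|i x Px].
- by rewrite -[quot_pi _ 1]/(1 : podles q c) t1.
- rewrite quot_piD -quot_piZ -[quot_scale _ _]/(k *: (_ : podles q c)).
  by rewrite tD //; exact: PD.
- rewrite -quot_piM -[quot_mul _ _]/((_ : podles q c) * _) tM //.
  by case: i; [exact: PB|exact: PA].
- rewrite -quot_piM -[quot_mul _ _]/((_ : podles q c) * _) tM //.
  rewrite -quot_piS -[quot_star _]/(star (_ : podles q c)) tS //.
  by case: i; [exact: PB'|exact: PA'].
Qed.

(** * The gauge action on matrix coefficients *)

Section Gauge.
Context {R : realType} {H : hilbertType R} (e : nat -> H).
Context (he : orthonormal_basis e).
Context (q : R) (c : \bar R) (C : cstar_closure (podles q c)).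
Context (s : bool) (rho : C -> H -> H) (hrho : podles_rep s e rho).
Local Notation A := (closure_A C).
Local Notation B := (closure_B C).
Local Notation lam j := (((podles_lambda c s * q ^+ (2 * j))%:C)%C : R[i]).
Local Notation wgt j := (((Num.sqrt (podles_weight q c s j))%:C)%C : R[i]).

Lemma rep_starA_basis j : rho (star A) (e j) = lam j *: e j.
Proof.
have [rr rA _ _] := hrho; apply: (basis_ext he) => k.
rewrite rep_adj // rA dotpZr dotpZl conjc_real.
by have [-> _] := he; case: eqP => [->|]; rewrite ?mulr0.
Qed.

Lemma rep_starB_basis j : rho (star B) (e j) = wgt j.+1 *: e j.+1.
Proof.
have [rr _ rB rB0] := hrho; have [on _] := he; apply: (basis_ext he) => -[|k].
  by rewrite rep_adj // rB0 dotp0r dotpZl on mulr0.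
rewrite rep_adj // rB dotpZr dotpZl conjc_real !on eqSS.
by case: eqP => [->|]; rewrite ?mulr0.
Qed.

Lemma coef_A a x j :
  dotp (rho (A * a) x) (e j) = lam j * dotp (rho a x) (e j).
Proof.
have [[_ _ _ rM adj] _ _ _] := hrho.
by rewrite rM /= adj rep_starA_basis dotpZr conjc_real.
Qed.

Lemma coef_starA a x j :
  dotp (rho (star A * a) x) (e j) = lam j * dotp (rho a x) (e j).
Proof.
have [rr rA _ _] := hrho; have [_ _ _ rM _] := rr.
by rewrite rM /= rep_adj // rA dotpZr conjc_real.
Qed.

Lemma coef_B a x j :
  dotp (rho (B * a) x) (e j) = wgt j.+1 * dotp (rho a x) (e j.+1).
Proof.
have [[_ _ _ rM adj] _ _ _] := hrho.
by rewrite rM /= adj rep_starB_basis dotpZr conjc_real.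
Qed.

Lemma coef_starB a x j : dotp (rho (star B * a) x) (e j) =
  if j is j'.+1 then wgt j * dotp (rho a x) (e j') else 0.
Proof.
have [rr _ rB rB0] := hrho; have [_ _ _ rM _] := rr.
rewrite rM /= rep_adj //; case: j => [|j]; first by rewrite rB0 dotp0r.
by rewrite rB dotpZr conjc_real.
Qed.

Context (rho_le : forall a, (opnorm (rho a) <= (cnorm a)%:E)%E).
Context (g : R[i]) (g1 : `|g| = 1) (d : C -> C) (hd : gauge_automorphism g d).

(** Conjugation by the diagonal unitary [u] described at the top, written without
    negative powers.  Each factor [B] contributes a factor [g ^ 2] to [d a] and
    lowers the index of basis vectors by one; [star B] does the reverse. *)
Lemma gauge_coef a i j :
  (g ^+ 2) ^+ j * dotp (rho (d a) (e i)) (e j)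
  = (g ^+ 2) ^+ i * dotp (rho a (e i)) (e j).
Proof.
have [rr _ _ _] := hrho; have [on _] := he.
have [[_ [d1 dD dM dS] diso] dA dB] := hd.
have [_ rD r1 _ _] := rr.
have zn : `|g ^+ 2| = 1 by rewrite normrX g1 expr1n.
set z : R[i] := g ^+ 2 in zn dB *.
have zJ : (z^*)%C * z = 1 by rewrite mulrC -sqr_normc zn expr1n.
have dB' : d (star B) = (z^*)%C *: star B by rewrite dS // dB starZ.
pose coef a0 j0 := dotp (rho a0 (e i)) (e j0).
have coefD k a1 a2 j0 : coef (k *: a1 + a2) j0 = k * coef a1 j0 + coef a2 j0.
  by rewrite /coef rD dotpDl dotpZl.
have coefZ k a1 j0 : coef (k *: a1) j0 = k * coef a1 j0.
  by rewrite /coef rep_scale // dotpZl.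
rewrite -/(coef (d a) j) -/(coef a j).
elim/closure_podles_ind: a j => [|k a b Pa Pb|a Pa|a Pa|a Pa|a Pa|a Pa] j.
- rewrite d1 /coef r1 on; case: eqP => [->//|_]; by rewrite !mulr0.
- rewrite dD // !coefD !mulrDr Pb; congr (_ + _).
  by rewrite mulrCA Pa mulrCA.
- by rewrite dM // dA /coef !coef_A mulrCA Pa mulrCA.
- by rewrite dM // dS // dA /coef !coef_starA mulrCA Pa mulrCA.
- rewrite dM // dB -scalerAl coefZ /coef !coef_B.
  by rewrite (mulrA (z ^+ j)) -exprSr mulrCA Pa mulrCA.
- rewrite dM // dB' -scalerAl coefZ /coef !coef_starB.
  case: j => [|j]; first by rewrite !mulr0.
  rewrite exprSr -mulrA (mulrA z) (mulrC z) zJ mul1r.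
  by rewrite mulrCA Pa mulrCA.
  (* The defect [f] of the identity is additive and
     bounded by twice the norm, so it vanishes at [a]. *)
- pose f b := z ^+ j * coef (d b) j - z ^+ i * coef b j.
  have fD b b' : f (b - b') = f b - f b'.
    have -> : b - b' = -1 *: b' + b by rewrite scaleN1r addrC.
    by rewrite /f dD // !coefD; ring.
  have coef_le b : `|coef b j| <= ((cnorm b)%:C)%C.
    by rewrite normc_le_real; exact: opnorm_coef_le.
  have f_le b : `|f b| <= ((cnorm b *+ 2)%:C)%C.
    apply: le_trans (ler_normB _ _) _.
    rewrite !normrM !normrX g1 !expr1n !mul1r.
    rewrite mulr2n rmorphD /=; apply: lerD => //.
    by rewrite -(diso b).
  apply/eqP; rewrite -subr_eq0 -/(f a); apply/negP => /negP fa0.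
  have r0 : 0 < complex.Re `|f a|.
    by move: fa0; rewrite -normr_gt0 normc_def ltcE /= => /andP[].
  have [b Pb ab] := Pa _ (divr_gt0 r0 (ltr0n R 2)).
  have fb : f b = 0 by apply/eqP; rewrite subr_eq0 Pb.
  have := f_le (a - b); rewrite fD fb subr0 normc_le_real.
  by rewrite leNgt -mulr_natr -ltr_pdivlMr // ab.
Qed.
End Gauge.

(** * Consequences for the gauge automorphisms *)

Section GaugeTransport.
Context {R : realType} {H : hilbertType R} (e : nat -> H).
Context (he : orthonormal_basis e) (q : R).

(** As [gauge_coef] involves only [g] and the indices, the operator of [d a] is
    determined by that of [a], uniformly in the parameter and the sign.  This
    yields compatibility with [chi] (different parameters, same sign) as well as
    with the flip (same parameter, opposite signs). *)
Lemma gauge_transport (c c' : \bar R) (C : cstar_closure (podles q c))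
    (C' : cstar_closure (podles q c')) (s s' : bool)
    (rho : C -> H -> H) (rho' : C' -> H -> H) (g : R[i])
    (d : C -> C) (d' : C' -> C') (a : C) (a' : C') :
  podles_rep s e rho -> podles_rep s' e rho' ->
  (forall b, (opnorm (rho b) <= (cnorm b)%:E)%E) ->
  (forall b, (opnorm (rho' b) <= (cnorm b)%:E)%E) ->
  `|g| = 1 -> gauge_automorphism g d -> gauge_automorphism g d' ->
  rho a = rho' a' -> rho (d a) = rho' (d' a').
Proof.
move=> hr hr' le le' g1 hd hd' aa'.
have [rr _ _ _] := hr; have [rr' _ _ _] := hr'.
apply: (rep_eq he rr rr') => i j.
have z0 : (g ^+ 2) ^+ j != 0 by rewrite !expf_neq0 // -normr_gt0 g1.
by apply: (mulfI z0); rewrite (gauge_coef he hr) // (gauge_coef he hr') // aa'.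
Qed.

Lemma gauge_commute (c : \bar R) (C : cstar_closure (podles q c)) (s : bool)
    (rho : C -> H -> H) (g h : R[i]) (d d' : C -> C) (a : C) :
  podles_rep s e rho -> (forall b, (opnorm (rho b) <= (cnorm b)%:E)%E) ->
  `|g| = 1 -> `|h| = 1 -> gauge_automorphism g d -> gauge_automorphism h d' ->
  rho (d (d' a)) = rho (d' (d a)).
Proof.
move=> hr le g1 h1 hd hd'.
have [rr _ _ _] := hr.
apply: (rep_eq he rr rr) => i j.
have z0 : (g ^+ 2) ^+ j != 0 by rewrite !expf_neq0 // -normr_gt0 g1.
have w0 : (h ^+ 2) ^+ j != 0 by rewrite !expf_neq0 // -normr_gt0 h1.
apply: (mulfI w0); apply: (mulfI z0).
rewrite mulrCA (gauge_coef he hr le g1 hd) mulrCA.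
rewrite (gauge_coef he hr le h1 hd') [in RHS](gauge_coef he hr le h1 hd').
by rewrite [RHS]mulrCA (gauge_coef he hr le g1 hd) mulrCA.
Qed.

End GaugeTransport.

(** * Inverses of bijections onto subsets *)

Section Cinv.
Context {R : realType} {A : cstarAlgType R} {T : Type}.

Lemma cinvK (f : A -> T) : injective f -> cancel f (cinv f).
Proof.
by move=> fI a; apply: pinvKV; [move=> x y _ _ /fI|rewrite in_setE].
Qed.

Lemma cinvKr (f : A -> T) (D : set T) y :
  set_surj [set: A] D f -> D y -> f (cinv f y) = y.
Proof. by move=> fS Dy; apply: (surjpK _ fS); rewrite in_setE. Qed.

End Cinv.

(** * The antipodal action *)

Theorem mainTheorem11 (R : realType) (q : R) (hq : 0 < `|q| < 1)
  (CS : forall c : podles_param R, cstar_closure (podles q (sval c)))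
  (H : hilbertType R) (e : nat -> H) (he : orthonormal_basis e)
  (Sh : H -> H) (hSh : unilateral_shift e Sh)
  (sigma : (H -> H) -> circle R -> R[i]^o) (hsigma : symbol_map Sh sigma)
  (* the representations pi^c_+ (false) and pi^c_- (true) *)
  (pi : forall c : podles_param R, bool -> CS c -> H -> H)
  (hpi : forall c s, podles_rep s e (pi c s))
  (* the known isomorphism theorem for pi^c_+ (+) pi^c_- *)
  (hiso : forall c, pair_cstar_iso (toeplitz_pullback Sh sigma)
                      (fun a => (pi c false a, pi c true a)))
  (delta : forall c : podles_param R, R[i] -> CS c -> CS c)
  (hdelta : forall c (g : R[i]), `|g| = 1 -> gauge_automorphism g (delta c g))
  (c : podles_param R) :
  let oo := param_infty R in
  let pipi c (a : CS c) := (pi c false a, pi c true a) in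
  let r1 : CS oo -> CS oo := cinv (pipi oo) \o swap_pair \o pipi oo in
  let r2 : CS oo -> CS oo := r1 \o delta oo 'i%C in
  let chi : CS c -> CS oo := cinv (pipi oo) \o pipi c in
  let r1c : CS c -> CS c := cinv chi \o r1 \o chi in
  let r2c : CS c -> CS c := cinv chi \o r2 \o chi in
  [/\ cstar_isomorphic [set a : CS c | r2c a = a] [set a : CS oo | r2 a = a],
      r2c = r1c \o delta c 'i%C /\
      r1c \o delta c 'i%C = delta c 'i%C \o r1c
    & forall g : R[i], `|g| = 1 -> delta c g \o r2c = r2c \o delta c g].
Proof.
move=> oo pipi r1 r2 chi r1c r2c.
have pipi_inj c' : injective (pipi c').
  by have [_ _ [_ inj _] _] := hiso c'; move=> a b; apply: inj; rewrite in_setE.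
have pipi_in c' a : toeplitz_pullback Sh sigma (pipi c' a).
  by have [_ _ [mem _ _] _] := hiso c'; exact: mem.
have pipiK c' y : toeplitz_pullback Sh sigma y ->
    pipi c' (cinv (pipi c') y) = y.
  by have [_ _ [_ _ srj] _] := hiso c'; exact: cinvKr.
have pi_le c' s a : (opnorm (pi c' s a) <= (cnorm a)%:E)%E.
  by have [_ _ _ ->] := hiso c'; rewrite le_max; case: s; rewrite lexx ?orbT.
have chiE a : pipi oo (chi a) = pipi c a by exact/pipiK/pipi_in.
have chiEs s a : pi oo s (chi a) = pi c s a.
  by case: s; have [] := chiE a.
have chi_inj : injective chi.
  by move=> a b ab; apply: pipi_inj; rewrite -!chiE ab.
have chiK : cancel chi (cinv chi) by exact: cinvK.
have chi_surj b : exists a, chi a = b.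
  exists (cinv (pipi c) (pipi oo b)); apply: pipi_inj.
  by rewrite chiE; exact/pipiK/pipi_in.
have cinvchiK : cancel (cinv chi) chi by move=> b; have [a <-] := chi_surj b; rewrite chiK.
have r1E a : pipi oo (r1 a) = swap_pair (pipi oo a).
  by apply: pipiK; have [? ? ?] := pipi_in oo a; split.
have r1Es s a : pi oo s (r1 a) = pi oo (~~ s) a.
  by case: s; have [] := r1E a.
have ext (a b : CS oo) : (forall s, pi oo s a = pi oo s b) -> a = b.
  by move=> ab; apply: pipi_inj; rewrite /pipi !ab.
have chi_delta (g : R[i]) a : `|g| = 1 -> chi (delta c g a) = delta oo g (chi a).
  move=> g1; apply: ext => s; rewrite chiEs.
  by apply: (gauge_transport he (hpi _ _) (hpi _ _) _ _ g1) => //; exact: hdelta.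
have r1_delta (g : R[i]) a : `|g| = 1 -> r1 (delta oo g a) = delta oo g (r1 a).
  move=> g1; apply: ext => s; rewrite r1Es; symmetry.
  by apply: (gauge_transport he (hpi _ _) (hpi _ _) _ _ g1) => //; exact: hdelta.
have deltaC (g h : R[i]) a : `|g| = 1 -> `|h| = 1 ->
    delta oo g (delta oo h a) = delta oo h (delta oo g a).
  move=> g1 h1; apply: ext => s.
  exact: (gauge_commute he a (hpi oo s) (pi_le oo s) g1 h1
            (hdelta oo g g1) (hdelta oo h h1)).
(* From here on only the compatibilities above are used. *)
have i1 : `|'i%C : R[i]| = 1 by rewrite normc_def /= expr0n expr1n add0r sqrtr1.
split.
- exists chi; split.
  + split=> [a /= ra|a b _ _|b /= rb]; [|exact: chi_inj|].
      by rewrite -{2}ra /r2c /= cinvchiK.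
    by exists (cinv chi b); rewrite /= ?cinvchiK // /r2c /= cinvchiK rb.
  + split=> [|k a b _ _|a b _ _|a _]; apply: ext => s; rewrite ?chiEs;
      have [[_ linc onec mulc adjc] _ _ _] := hpi c s;
      have [[_ lin one mul adj] _ _ _] := hpi oo s.
    * by rewrite one onec.
    * by apply: funext => x; rewrite linc lin !chiEs.
    * by rewrite mulc mul !chiEs.
    * apply: funext => x; apply: (basis_ext he) => j.
      have [rc _ _ _] := hpi c s; have [ro _ _ _] := hpi oo s.
      by rewrite !rep_adj // chiEs.
  + move=> a _; apply: EFin_inj.
    by have [_ _ _ ->] := hiso c; have [_ _ _ ->] := hiso oo; rewrite !chiEs.
- split; apply: funext => a; rewrite /r2c /r1c /r2 /=.
    by rewrite chi_delta.
  by apply: chi_inj; rewrite cinvchiK !chi_delta // cinvchiK r1_delta.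
- move=> g g1; apply: funext => a; rewrite /r2c /r2 /=.
  apply: chi_inj; rewrite cinvchiK !chi_delta // cinvchiK.
  by rewrite -r1_delta // deltaC.
Qed.
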